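(* Let $p$ be a real number in $(0,1)$. If $p$ lies in the interval $[\frac13,\frac23]$, then $$\min_{(X_1,X_2)\in\mathcal{C}_p}\mathrm{cov}(X_1,X_2)=-\frac18\,p(1-p).$$ If $p$ lies outside the interval $[\frac13,\frac23]$, then the strict inequality holds: $$\min_{(X_1,X_2)\in\mathcal{C}_p}\mathrm{cov}(X_1,X_2)>-\frac18\,p(1-p).$$
   Context: A probability distribution $\mu$ on $[0,1]^2$ is called coherent if there exist a probability space $(\Omega,\mathcal{F},\mathbb{P})$, a Bernoulli (i.e. $\{0,1\}$-valued) random variable $X$ on it, and two sub-sigma-algebras $\mathcal{F}_1,\mathcal{F}_2\subset\mathcal{F}$ such that $\mu$ is the joint distribution of $(X_1,X_2)$, where $X_i=\mathbb{E}[X\mid\mathcal{F}_i]$. $\mathcal{C}_p$ denotes the set of coherent distributions arising with $\mathbb{E}[X]=p$. One writes $(X_1,X_2)\in\mathcal{C}_p$ to indicate that the distribution of the random vector $(X_1,X_2)$ belongs to $\mathcal{C}_p$. *)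

(* Defs.v *)
From HB Require Import structures.
From mathcomp Require Import all_boot all_order all_algebra.
From mathcomp Require Import all_classical all_reals all_analysis.
Set Implicit Arguments.
Unset Strict Implicit.
Unset Printing Implicit Defensive.
Import Order.TTheory GRing.Theory Num.Theory.
Import numFieldNormedType.Exports.
Local Open Scope classical_set_scope.
Local Open Scope ring_scope.

Section random_vector.
Context {d d1 d2} {T : measurableType d}
  {T1 : measurableType d1} {T2 : measurableType d2}.

Definition random_vector (X1 : {mfun T >-> T1}) (X2 : {mfun T >-> T2}) :
  T -> T1 * T2 := fun w => (X1 w, X2 w).

Variables (X1 : {mfun T >-> T1}) (X2 : {mfun T >-> T2}).

Let measurable_random_vector :
  measurable_fun [set: T] (random_vector X1 X2).
Proof. exact: measurable_fun_pair. Qed.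

HB.instance Definition _ :=
  isMeasurableFun.Build _ _ _ _ (random_vector X1 X2) measurable_random_vector.

End random_vector.

Definition sub_sigma_algebra_of {d} (T : measurableType d)
    (F : set (set T)) : Prop :=
  sigma_algebra [set: T] F /\ F `<=` measurable.

(* [Y] is a version of the conditional expectation E[X | F]; versions differ
   only on P-null sets. *)
Definition cond_expectation {d} {T : measurableType d} {R : realType}
    (P : probability T R) (X : T -> R) (F : set (set T)) (Y : T -> R) : Prop :=
  [/\ forall B : set R, measurable B -> F (Y @^-1` B),
      P.-integrable [set: T] (EFin \o Y) &
      forall A, F A -> (\int[P]_(w in A) (Y w)%:E = \int[P]_(w in A) (X w)%:E)%E].

(* A distribution on the unit square is encoded as a probability on the plane
   giving full mass to the square. *)
Definition coherent {R : realType} (p : R) (mu : probability (R * R)%type R) :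
    Prop :=
  mu (`[0, 1] `*` `[0, 1]) = 1%E /\
  exists (d : measure_display) (T : measurableType d) (P : probability T R)
         (X : {RV P >-> R}) (F1 F2 : set (set T)) (X1 X2 : {RV P >-> R}),
    [/\ forall w, X w = 0 \/ X w = 1,
        ('E_P[X] = p%:E)%E,
        sub_sigma_algebra_of F1 /\ sub_sigma_algebra_of F2,
        cond_expectation P X F1 X1 /\ cond_expectation P X F2 X2 &
        forall A, measurable A -> mu A = distribution P (random_vector X1 X2) A].

Definition coherent_covariances {R : realType} (p : R) : set (\bar R) :=
  [set c | exists (d : measure_display) (T : measurableType d)
             (P : probability T R) (X1 X2 : {RV P >-> R}),
     coherent p (distribution P (random_vector X1 X2)) /\
     c = covariance P X1 X2].

Definition is_minimum {disp} {T : porderType disp} (S : set T) (m : T) : Prop :=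
  S m /\ lbound S m.

(* Main.v *)
Require Import Defs.
From HB Require Import structures.
From mathcomp Require Import all_boot all_order all_algebra.
From mathcomp Require Import all_classical all_reals all_analysis.
From mathcomp Require Import finmap measurable_realfun ring lra.
Import Order.TTheory GRing.Theory Num.Theory.
Import HBNNSimple.
Local Open Scope classical_set_scope.
Local Open Scope ring_scope.

(** Since both coordinates have mean [p], the problem is to minimise
    E[X1 X2], a linear functional of the joint law of (X, X1, X2).  The
    constraints on that law are also linear: E[phi(Xi) (X - Xi)] = 0 for every
    bounded measurable [phi] ([integral_pullout]).  Lower bounds therefore come
    from linear programming duality: if

      x y + phi(x) (theta - x) + phi(y) (theta - y) >= c_theta

    for all [x], [y] in [0, 1] and [theta] in {0, 1}, then taking expectations
    gives E[X1 X2] >= (1 - p) c_0 + p c_1 ([expectation_ge_dual],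
    [covariance_ge_dual]).  Upper bounds come from laws carried by four points:
    the edges of a path 0 - y1 - x - y2 - 1 whose vertices are alternately
    values of [X1] and of [X2], with X = 0, 1, 0, 1 along the edges
    ([chain_covariance]).

    For [p] in [1/3, 2/3] the potential is [phi x = 3p/2 - x/2].  Both sides of
    the dual inequality then differ by a square, and this is the Hilbert space
    identity 8 cov(X1, X2) + Var X = 4 E[(X1 + X2 - 2p - (X - p)/2)^2].
    The square vanishes along the path 0 - 3p/2 - 1/2 - (3p-1)/2 - 1, whose
    vertices lie in [0, 1] exactly for these [p] ([min_middle]).

    For [p < 1/3] the optimal law uses the three edges of 0 - t - t - 0 with
    [t = 2p/(1+p)], and has covariance -(p(1-p)/(1+p))^2.  Being optimal on
    these edges forces [phi t = t^2] and [phi' t = -t]; the potential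
    [dual_potential t] meets this with a quadratic below [t] and with [t^3/x]
    above it.  For [t <= 1/2], that is [p <= 1/3], its feasibility reduces to
    the polynomial inequalities [cubic_bound] and [straddle_bound]
    ([min_low]).  Exchanging 0 and 1, so that the potential becomes
    [1 - phi (1 - x)], treats [p > 2/3] ([min_high]).

    Outside [1/3, 2/3] the two values differ by a multiple of (3p - 1)^2 or
    (3p - 2)^2, hence the strict inequality. *)

(** * A dual potential for small prior probability *)

(** In terms of [X = t - x] and [Z = t - z] this says
    [X^3 + Z^3 + 4 t (t - X) (t - Z) >= t^3].  For a given sum [s = X + Z] the
    left-hand side is affine in the product [X Z], which lies above 0 and
    [t (s - t)] (equality when [x z = 0]) and below [s^2 / 4] (equality when
    [x = z]); the sign of the slope [4 t - 3 s] decides which bound matters. *)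
Lemma cubic_bound {R : realFieldType} (t x z : R) :
  0 <= x <= t -> 0 <= z <= t ->
  x * (t - x) ^+ 2 + z * (t - z) ^+ 2 <= t * (t - x - z) ^+ 2 + 2 * t * x * z.
Proof.
move=> /andP[x0 xt] /andP[z0 zt].
have t0 : 0 <= t := le_trans x0 xt.
have [s sE] : exists s, s = 2 * t - x - z by exists (2 * t - x - z).
have q0 : 0 <= (t - x) * (t - z) by rewrite mulr_ge0 ?subr_ge0.
have qE : (t - x) * (t - z) = t * (s - t) + x * z by rewrite sE; ring.
have q2 : (t - x) * (t - z) <= s ^+ 2 / 4.
  rewrite -subr_ge0.
  suff -> : s ^+ 2 / 4 - (t - x) * (t - z) = ((x - z) / 2) ^+ 2.
    exact: sqr_ge0.
  by rewrite sE; field.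
rewrite -subr_ge0.
have -> : t * (t - x - z) ^+ 2 + 2 * t * x * z
   - (x * (t - x) ^+ 2 + z * (t - z) ^+ 2) =
   (s - t) * (s ^+ 2 + s * t - 3 * t ^+ 2)
   + (t - x) * (t - z) * (4 * t - 3 * s).
  by rewrite sE; ring.
move: qE q0 q2; set q := (t - x) * (t - z) => qE q0 q2.
have xz0 : 0 <= x * z by exact: mulr_ge0.
have s0 : 0 <= s by lra.
have [st|st] := leP s t.
  apply: addr_ge0; last by apply: mulr_ge0 => //; lra.
  by apply: mulr_le0; [lra|nra].
have [st'|st'] := leP (3 * s) (4 * t).
  have -> : (s - t) * (s ^+ 2 + s * t - 3 * t ^+ 2) + q * (4 * t - 3 * s)
    = (s - t) ^+ 3 + x * z * (4 * t - 3 * s) by rewrite qE; ring.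
  apply: addr_ge0; first by rewrite exprn_ge0// subr_ge0 ltW.
  by apply: mulr_ge0 => //; lra.
(* at X Z = s^2 / 4 a cubic in s remains; its minimum over s >= 0, equal to
   t^3 / 27, is at s = 4 t / 3 *)
have -> : (s - t) * (s ^+ 2 + s * t - 3 * t ^+ 2) + q * (4 * t - 3 * s)
  = t ^+ 3 / 27 + (s - 4 / 3 * t) ^+ 2 * (t * (5/3) + s / 4)
  + (s ^+ 2 / 4 - q) * (3 * s - 4 * t) by field.
apply: addr_ge0; last by apply: mulr_ge0; lra.
apply: addr_ge0; first by apply: divr_ge0; rewrite ?exprn_ge0.
by apply: mulr_ge0; [exact: sqr_ge0|lra].
Qed.

(** Feasibility of [dual_potential] for [theta = 1] at a pair [x <= t <= y], in
    the scale-free variables [z = x / t] and [r = t / y]; the condition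
    [t <= r] is what remains of [y <= 1]. *)
Lemma straddle_bound {R : realFieldType} (t r z : R) :
  0 <= t <= 1 / 2 -> t <= r <= 1 -> 0 <= z <= 1 ->
  (1 - r) * (r - z) <= r * (1 - z) ^+ 2 * (1 - t - (1 - 2 * t) * t * z).
Proof.
move=> /andP[t0 th] /andP[tr r1] /andP[z0 z1].
(* the right-hand side decreases in t, so t is raised to min(r, 1/2) *)
have W s : t <= s -> s <= 1 / 2 ->
    1 - s - (1 - 2 * s) * s * z <= 1 - t - (1 - 2 * t) * t * z.
  move=> ts sh; rewrite -subr_ge0.
  have -> : 1 - t - (1 - 2 * t) * t * z - (1 - s - (1 - 2 * s) * s * z)
     = (s - t) * ((1 - z) + 2 * z * (1 - s - t)) by ring.
  by apply: mulr_ge0; [lra|nra].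
have rz0 : 0 <= r * (1 - z) ^+ 2 by rewrite mulr_ge0 ?sqr_ge0//; lra.
have [rh|rh] := leP r (1 / 2).
  apply: le_trans (ler_wpM2l rz0 (W r tr rh)); rewrite -subr_ge0.
  have -> : r * (1 - z) ^+ 2 * (1 - r - (1 - 2 * r) * r * z)
      - (1 - r) * (r - z)
    = z * ((1 - r) * r * z + (1 - 2 * r) * (1 - r - (r * (1 - z)) ^+ 2)).
    by ring.
  have r0 : 0 <= r := le_trans t0 tr.
  have rz : 0 <= r * (1 - z) <= 1 / 2 by apply/andP; split; nra.
  have rz2 : (r * (1 - z)) ^+ 2 <= 1 - r by nra.
  by rewrite mulr_ge0// addr_ge0// mulr_ge0//; try nra; lra.
apply: le_trans (ler_wpM2l rz0 (W (1 / 2) th (lexx _))).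
rewrite -subr_ge0 -(pmulr_rge0 _ (_ : 0 < r)); last by lra.
have -> : r * (r * (1 - z) ^+ 2 * (1 - 1 / 2 - (1 - 2 * (1 / 2)) * (1 / 2) * z)
    - (1 - r) * (r - z)) =
  ((r * z - (2 * r - 1)) ^+ 2 + (2 * r - 1) * (1 - r) ^+ 2) / 2 by field.
apply: divr_ge0 => //; apply: addr_ge0; first exact: sqr_ge0.
by rewrite mulr_ge0 ?sqr_ge0//; lra.
Qed.

(** The solution of the dual problem for the prior with [t = 2p / (1 + p)].  On
    [x >= t] it gives [x phi x] the largest value compatible with the
    [theta = 0] constraint at the pair [(x, 0)].  On [x <= t] the linear part
    has the forced value [t^2] and slope [-t] at [t], and the coefficient
    [1 - 2t] of the square makes the [theta = 1] constraint tight at the pair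
    [(0, 1)]. *)
Definition dual_potential {R : realFieldType} (t x : R) : R :=
  if x <= t then t * (2 * t - x) + (1 - 2 * t) * (t - x) ^+ 2 else t ^+ 3 / x.

Lemma mul_dual_potential_low {R : realFieldType} (t x : R) : x <= t ->
  x * dual_potential t x = t ^+ 3 - (t - x) ^+ 2 * (t - (1 - 2 * t) * x).
Proof. by rewrite /dual_potential => ->; ring. Qed.

Lemma dual_potential_high {R : realFieldType} (t x : R) : 0 < t -> t <= x ->
  dual_potential t x = t ^+ 3 / x.
Proof.
rewrite /dual_potential => t0 tx; case: ifP => // xt.
have -> : x = t by apply/le_anti; rewrite tx xt.
by field; rewrite gt_eqF.
Qed.

Lemma mul_dual_potential_high {R : realFieldType} (t x : R) : 0 < t -> t <= x ->
  x * dual_potential t x = t ^+ 3.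
Proof.
move=> t0 tx; rewrite dual_potential_high// mulrC divfK//.
by rewrite gt_eqF// (lt_le_trans t0).
Qed.

Lemma dual_potential_feasible0 {R : realFieldType} (t x y : R) :
  0 < t <= 1 / 2 -> 0 <= x -> 0 <= y ->
  x * dual_potential t x + y * dual_potential t y <= x * y + t ^+ 3.
Proof.
move=> /andP[t0 th] x0 y0.
have low u v : 0 <= u <= t -> 0 <= v <= t ->
    u * dual_potential t u + v * dual_potential t v <= u * v + t ^+ 3.
  move=> /[dup] /andP[u0 ut] u0t /[dup] /andP[v0 vt] v0t.
  rewrite !mul_dual_potential_low//.
  have uv0 : 0 <= u * v by exact: mulr_ge0.
  (* with d = 1 - 2 t, the slack is
     t (t - u - v)^2 + d (u v - u (t - u)^2 - v (t - v)^2); writing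
     1 = 2 t + d in front of t (t - u - v)^2 and of u v isolates d times the
     slack of the cubic inequality *)
  have c : 0 <= (1 - 2 * t) * (t * (t - u - v) ^+ 2 + 2 * t * u * v
      - (u * (t - u) ^+ 2 + v * (t - v) ^+ 2)).
    by apply: mulr_ge0; [lra|rewrite subr_ge0; exact: cubic_bound].
  have sq0 : 0 <= 2 * t * (t * (t - u - v) ^+ 2) + (1 - 2 * t) ^+ 2 * (u * v).
    apply: addr_ge0; last by rewrite mulr_ge0 ?sqr_ge0.
    by apply: mulr_ge0; [lra|rewrite mulr_ge0 ?sqr_ge0 ?ltW].
  rewrite -subr_ge0; apply: (le_trans (addr_ge0 sq0 c)).
  by rewrite le_eqVlt; apply/orP; left; apply/eqP; ring.
have mix u v : 0 <= u <= t -> t <= v ->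
    u * dual_potential t u + v * dual_potential t v <= u * v + t ^+ 3.
  move=> /[dup] /andP[u0 ut] u0t tv.
  have := low u t u0t; rewrite lexx ltW// => /(_ isT).
  rewrite (mul_dual_potential_high _ _ t0 tv).
  rewrite (mul_dual_potential_high _ _ t0 (lexx t)).
  by move=> h; apply: (le_trans h); rewrite lerD2r; exact: ler_wpM2l.
have [xt|/ltW tx] := leP x t; have [yt|/ltW ty] := leP y t.
- by apply: low; apply/andP.
- by apply: mix => //; apply/andP.
- by rewrite addrC [x * y]mulrC; apply: mix => //; apply/andP.
- rewrite !mul_dual_potential_high//.
  have : t * t <= x * y by rewrite ler_pM// ltW.
  have t3 : t ^+ 3 <= t * t by rewrite exprS expr2; nra.
  lra.
Qed.

(** Below or above [t] in both variables, tangent lines to [(1 - x) phi x] at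
    [t] leave [(x - t) (y - t) >= 0]; the tangents are too weak when [t]
    separates [x] from [y], and [straddle_bound] replaces them. *)
Lemma dual_potential_feasible1 {R : realFieldType} (t x y : R) :
  0 < t <= 1 / 2 -> 0 <= x <= 1 -> 0 <= y <= 1 ->
  3 * t ^+ 2 - 2 * t ^+ 3 <=
  x * y + (1 - x) * dual_potential t x + (1 - y) * dual_potential t y.
Proof.
move=> /andP[t0 th].
have mix u v : 0 <= u <= 1 -> 0 <= v <= 1 -> u <= t -> t <= v ->
    3 * t ^+ 2 - 2 * t ^+ 3 <=
    u * v + (1 - u) * dual_potential t u + (1 - v) * dual_potential t v.
  move=> /andP[u0 u1] /andP[v0 v1] ut tv; rewrite (dual_potential_high t v)//.
  have v'0 : 0 < v := lt_le_trans t0 tv.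
  have tne : t != 0 by rewrite gt_eqF.
  have vne : v != 0 by rewrite gt_eqF.
  have r1 : t <= t / v <= 1.
    apply/andP; split; first by rewrite ler_pdivlMr// ler_piMr// ltW.
    by rewrite ler_pdivrMr// mul1r.
  have z1 : 0 <= u / t <= 1.
    by apply/andP; split; [rewrite divr_ge0// ltW|rewrite ler_pdivrMr// mul1r].
  have := straddle_bound t (t / v) (u / t); rewrite ltW// th => /(_ isT r1 z1).
  rewrite -subr_ge0 => h.
  rewrite -subr_ge0 /dual_potential ut.
  have -> : u * v + (1 - u) * (t * (2 * t - u) + (1 - 2 * t) * (t - u) ^+ 2) +
    (1 - v) * (t ^+ 3 / v) - (3 * t ^+ 2 - 2 * t ^+ 3) =
    (t * v) * (t / v * (1 - u / t) ^+ 2 * (1 - t - (1 - 2 * t) * t * (u / t)) -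
       (1 - t / v) * (t / v - u / t)) by field; rewrite tne vne.
  by apply: mulr_ge0 => //; rewrite mulr_ge0// ltW.
move=> x01 y01.
have [xt|/ltW tx] := leP x t; have [yt|/ltW ty] := leP y t.
- rewrite /dual_potential xt yt.
  have V u : 0 <= u <= 1 -> u <= t ->
      t * (2 * t - u - t ^+ 2) <=
      (1 - u) * (t * (2 * t - u) + (1 - 2 * t) * (t - u) ^+ 2).
    move=> /andP[u0 u1] ut; rewrite -subr_ge0.
    have -> : (1 - u) * (t * (2 * t - u) + (1 - 2 * t) * (t - u) ^+ 2)
        - t * (2 * t - u - t ^+ 2)
      = (t + (1 - 2 * t) * (1 - u)) * (t - u) ^+ 2 by ring.
    apply: mulr_ge0; last exact: sqr_ge0.
    by apply: addr_ge0; [exact: ltW|apply: mulr_ge0; lra].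
  have := V x x01 xt; have := V y y01 yt.
  have : 0 <= (t - x) * (t - y) by rewrite mulr_ge0// subr_ge0.
  by rewrite !exprS !expr0 !mulr1; lra.
- exact: mix.
- by rewrite [x * y]mulrC addrAC; apply: mix.
- have V u : t <= u ->
      t * (3 * t - u - t ^+ 2) - t ^+ 2 <= (1 - u) * dual_potential t u.
    move=> tu; rewrite dual_potential_high// -subr_ge0.
    have u0 : 0 < u := lt_le_trans t0 tu.
    have -> : (1 - u) * (t ^+ 3 / u) - (t * (3 * t - u - t ^+ 2) - t ^+ 2) =
      t * (t - u) ^+ 2 / u by field; rewrite gt_eqF.
    apply: divr_ge0; last exact: ltW.
    by apply: mulr_ge0; [exact: ltW|exact: sqr_ge0].
  have := V x tx; have := V y ty.
  have : 0 <= (x - t) * (y - t) by rewrite mulr_ge0// subr_ge0.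
  rewrite !exprS !expr0 !mulr1; lra.
Qed.

(** Monotonicity yields both the measurability and the bounds needed to use
    [dual_potential] as a test function. *)
Lemma dual_potential_nonincreasing {R : realFieldType} (t : R) :
  0 < t <= 1 / 2 -> {homo dual_potential t : x y /~ x <= y}.
Proof.
move=> /andP[t0 th] y x xy.
have low u : u <= t ->
    dual_potential t u = t * (2 * t - u) + (1 - 2 * t) * (t - u) ^+ 2.
  by rewrite /dual_potential => ->.
have [yt|/ltW ty] := leP y t.
  have xt := le_trans xy yt; rewrite !low//; apply: lerD.
    by rewrite ler_pM2l// lerD2l lerN2.
  by apply: ler_wpM2l; [lra|rewrite ler_sqr ?nnegrE; lra].
have ty2 : dual_potential t y <= t ^+ 2.
  rewrite dual_potential_high// ler_pdivrMr ?(lt_le_trans t0)// exprSr.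
  by rewrite ler_pM2l// exprn_gt0.
have [xt|/ltW tx] := leP x t; last first.
  rewrite !dual_potential_high// ler_pM2l ?exprn_gt0// lef_pV2// posrE.
    exact: lt_le_trans ty.
  exact: lt_le_trans tx.
apply: (le_trans ty2); rewrite low// -subr_ge0.
have -> : t * (2 * t - x) + (1 - 2 * t) * (t - x) ^+ 2 - t ^+ 2 =
  (t - x) * (t + (1 - 2 * t) * (t - x)) by ring.
apply: mulr_ge0; first by rewrite subr_ge0.
by apply: addr_ge0; [exact: ltW|apply: mulr_ge0; lra].
Qed.

Lemma dual_potential01 {R : realFieldType} (t x : R) : 0 < t <= 1 / 2 ->
  0 <= x <= 1 -> 0 <= dual_potential t x <= 1.
Proof.
move=> t01 /andP[x0 x1]; have mono := dual_potential_nonincreasing t t01.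
case/andP: t01 => t0 th; apply/andP; split.
  apply: le_trans (mono _ _ x1); rewrite dual_potential_high//; last by lra.
  by rewrite divr1 exprn_ge0// ltW.
apply: (le_trans (mono _ _ x0)); rewrite /dual_potential (ltW t0).
have -> : t * (2 * t - 0) + (1 - 2 * t) * (t - 0) ^+ 2
  = t * (t * (3 - 2 * t)) by ring.
by apply: mulr_ile1; nra.
Qed.

Lemma measurable_dual_potential {R : realType} (t : R) : 0 < t <= 1 / 2 ->
  measurable_fun [set: R] (dual_potential t).
Proof.
move=> t01; apply: nonincreasing_measurable => // x y xy.
exact: dual_potential_nonincreasing.
Qed.


(** * Duality for conditional expectations *)

(** The orthogonality of [X - E[X | F]] to functions of [E[X | F]].  It holds
    for indicators by definition of the conditional expectation, hence for
    simple functions, and passes to the limit by dominated convergence along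
    simple functions increasing to [phi]. *)
Lemma integral_pullout {d} {T : measurableType d} {R : realType}
    (P : probability T R) (X : T -> R) (F : set (set T)) (Y : {RV P >-> R})
    (phi : R -> R) (M : R) :
  F `<=` measurable -> P.-integrable [set: T] (EFin \o X) ->
  cond_expectation P X F Y -> measurable_fun [set: R] phi ->
  (forall y, 0 <= phi y <= M) ->
  (\int[P]_w (phi (Y w) * (X w - Y w))%:E = 0)%E.
Proof.
move=> Fm iX [YF iY YX] mphi phiM.
have phi0 y : setT y -> (0 <= (EFin \o phi) y)%E.
  by move=> _; rewrite lee_fin; case/andP: (phiM y).
have mD : measurable_fun [set: T] (fun w => X w - Y w).
  apply: measurable_funB => //.
  by apply/measurable_EFinP; exact: measurable_int iX.
have iD : P.-integrable [set: T] (EFin \o (fun w => X w - Y w)).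
  by rewrite (_ : _ \o _ = (EFin \o X) \- (EFin \o Y))%E//; exact: integrableB.
have mphi' : measurable_fun [set: R] (EFin \o phi) by exact/measurable_EFinP.
pose g := nnsfun_approx measurableT mphi'.
have gphi n y : g n y <= phi y.
  rewrite -lee_fin /g nnsfun_approxE.
  by apply: (@le_approx _ _ _ setT (EFin \o phi)).
have mg n : measurable_fun [set: T] (g n \o Y) by exact: measurableT_comp.
have mphiY : measurable_fun [set: T] (phi \o Y) by exact: measurableT_comp.
have ind0 B : measurable B -> (\int[P]_(w in Y @^-1` B) (X w - Y w)%:E = 0)%E.
  move=> mB; have FB := YF _ mB; have mYB := Fm _ FB.
  have iXB := integrableS measurableT mYB (@subsetT _ _) iX.
  have iYB := integrableS measurableT mYB (@subsetT _ _) iY.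
  rewrite integralB_EFin// YX// subee//.
  exact: integrable_fin_num.
pose D w := (X w - Y w)%:E.
have g0 n : (\int[P]_w (g n (Y w) * (X w - Y w))%:E = 0)%E.
  pose A r := Y @^-1` (g n @^-1` [set r]).
  have mB r : measurable (g n @^-1` [set r]) by exact: measurable_funPTI.
  have mA r : measurable (A r) by exact: measurable_funPTI.
  have iA r : P.-integrable [set: T] (D \_ (A r)).
    apply/(integrable_mkcond _ (mA r)).
    exact: (integrableS measurableT (mA r) (@subsetT _ _) iD).
  pose s : seq R := fset_set (range (g n)).
  transitivity (\int[P]_w (\sum_(r <- s) r%:E * (D \_ (A r)) w))%E.
    apply: eq_integral => w _.
    rewrite fimfunE fsbig_finite//= mulr_suml -sumEFin.
    apply: eq_bigr => r _; rewrite -mulrA EFinM; congr (_ * _)%E.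
    rewrite patchE indicE.
    have -> : (Y w \in g n @^-1` [set r]) = (w \in A r).
      by apply/idP/idP; rewrite !in_setE.
    by case: ifP; rewrite /= ?mul1r ?mul0r.
  rewrite integral_sum//; last by move=> r; exact: integrableZl.
  rewrite big1// => r _; rewrite integralZl//.
  by rewrite -integral_mkcond [X in (_ * X)%E]ind0// mule0.
pose fn n w := (g n (Y w) * (X w - Y w))%:E.
pose f w := (phi (Y w) * (X w - Y w))%:E.
have mfn n : measurable_fun [set: T] (fn n).
  by apply/measurable_EFinP; exact: (measurable_funM (mg n) mD).
have mf : measurable_fun [set: T] f.
  by apply/measurable_EFinP; exact: (measurable_funM mphiY mD).
have fnf : {ae P, forall w, [set: T] w -> fn ^~ w @ \oo --> f w}.
  apply: aeW => w _; rewrite /fn /f; under eq_fun do rewrite EFinM.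
  rewrite EFinM; apply: cvgeZr => //.
  exact: (@cvg_nnsfun_approx _ _ _ _ measurableT _ mphi').
have iMD : P.-integrable [set: T] (fun w => M%:E * `|D w|)%E.
  by apply: integrableZl => //; exact: integrable_abse.
have fnM : {ae P, forall w n, [set: T] w -> (`|fn n w| <= M%:E * `|D w|)%E}.
  apply: aeW => w n _; rewrite /fn EFinM abseM lee_wpmul2r//.
  rewrite gee0_abs ?lee_fin//.
  by apply: le_trans (gphi n _) _; case/andP: (phiM (Y w)).
have [_ _] := dominated_convergence measurableT mfn mf fnf iMD fnM.
under eq_fun do rewrite g0.
move=> h; apply/esym.
by apply: cvg_unique h; [exact: ereal_hausdorff|exact: cvg_cst].
Qed.

Lemma integrable_bounded_full {d} {T : measurableType d} {R : realType}
    (P : probability T R) (D : set T) (f : T -> R) (M : R) :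
  measurable D -> P D = 1%E -> measurable_fun [set: T] f ->
  (forall w, D w -> `|f w| <= M) -> P.-integrable [set: T] (EFin \o f).
Proof.
move=> mD PD mf fM.
have mf' : measurable_fun [set: T] (EFin \o f) by exact/measurable_EFinP.
have PDC : P (~` D) = 0%E.
  by rewrite (probability_setC _ mD) [X in (_ - X)%E]PD subee.
apply/(negligible_integrable (measurableC mD) measurableT mf' PDC).
rewrite setTD setCK; apply: measurable_bounded_integrable => //.
- by rewrite [X in (X < _)%E]PD ltry.
- exact: measurable_funTS.
- exists M; split; first exact: num_real.
  by move=> N MN w Dw; exact: le_trans (fM _ Dw) (ltW MN).
Qed.

Lemma integrable_EFinD {d} {T : measurableType d} {R : realType}
    (mu : {measure set T -> \bar R}) (f g : T -> R) :
  mu.-integrable [set: T] (EFin \o f) -> mu.-integrable [set: T] (EFin \o g) ->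
  mu.-integrable [set: T] (EFin \o (f \+ g)).
Proof. by move=> intf intg; exact: (integrableD measurableT intf intg). Qed.

Lemma integral_full {d} {T : measurableType d} {R : realType}
    (P : probability T R) (D : set T) (f : T -> \bar R) :
  measurable D -> P D = 1%E -> P.-integrable [set: T] f ->
  (\int[P]_w f w = \int[P]_(w in D) f w)%E.
Proof.
move=> mD PD intf.
have PDC : P (~` D) = 0%E.
  by rewrite (probability_setC _ mD) [X in (_ - X)%E]PD subee.
rewrite (negligible_integral (measurableC mD) measurableT intf PDC).
by rewrite setTD setCK.
Qed.

Definition unit_square {R : realType} : set (R * R) := `[0, 1] `*` `[0, 1].

Lemma measurable_unit_square {R : realType} : measurable (@unit_square R).
Proof. exact: measurableX. Qed.

Lemma unit_squareP {R : realType} (z : R * R) :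
  unit_square z <-> 0 <= z.1 <= 1 /\ 0 <= z.2 <= 1.
Proof. by rewrite /unit_square /= !in_itv. Qed.

Lemma measurable_unit_square_preimage {d} {T : measurableType d} {R : realType}
    (X1 X2 : {mfun T >-> R}) :
  measurable (random_vector X1 X2 @^-1` unit_square).
Proof. by apply: measurable_funPTI; exact: measurable_unit_square. Qed.

(** The probabilistic data witnessing [coherent], with the conditional
    expectations constrained to the unit square on their own space.  Being
    versions, they may leave [0, 1] on a null set. *)
Definition coherent_model {d} {T : measurableType d} {R : realType}
    (P : probability T R) (p : R) (X X1 X2 : {RV P >-> R}) : Prop :=
  exists F1 F2 : set (set T),
    [/\ forall w, X w = 0 \/ X w = 1,
        ('E_P[X] = p%:E)%E,
        sub_sigma_algebra_of F1 /\ sub_sigma_algebra_of F2,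
        cond_expectation P X F1 X1 /\ cond_expectation P X F2 X2 &
        P (random_vector X1 X2 @^-1` unit_square) = 1%E].

Lemma sub_sigma_algebraT {d} {T : measurableType d} (F : set (set T)) :
  sub_sigma_algebra_of F -> F [set: T].
Proof. by move=> [[F0 FC _] _]; rewrite -(setD0 [set: T]); exact: FC. Qed.

Lemma expectation_cond {d} {T : measurableType d} {R : realType}
    (P : probability T R) (X Y : {RV P >-> R}) (F : set (set T)) :
  sub_sigma_algebra_of F -> cond_expectation P X F Y -> ('E_P[Y] = 'E_P[X])%E.
Proof.
by move=> sF [_ _]; rewrite unlock; apply; exact: sub_sigma_algebraT.
Qed.

(** Weak duality: add the null quantities [phi(Xi) (X - Xi)] to [X1 X2] and
    integrate the two pointwise inequalities, which are the constraints at
    [X = 0] and at [X = 1]. *)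
Lemma expectation_ge_dual {d} {T : measurableType d} {R : realType}
    (P : probability T R) (p : R) (X X1 X2 : {RV P >-> R})
    (phi : R -> R) (c0 c1 : R) :
  coherent_model P p X X1 X2 ->
  measurable_fun [set: R] phi ->
  (forall x, 0 <= x <= 1 -> 0 <= phi x <= 1) ->
  (forall x y, 0 <= x <= 1 -> 0 <= y <= 1 ->
     c0 <= x * y - x * phi x - y * phi y) ->
  (forall x y, 0 <= x <= 1 -> 0 <= y <= 1 ->
     c1 <= x * y + (1 - x) * phi x + (1 - y) * phi y) ->
  (((1 - p) * c0 + p * c1)%:E <= 'E_P[(X1 \* X2)%R])%E.
Proof.
move=> [F1 [F2 [X01 EX [sF1 sF2] [cX1 cX2] PD]]] mphi phi01 H0 H1.
set D := _ @^-1` _ in PD.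
have mD : measurable D by exact: measurable_unit_square_preimage.
have iX : P.-integrable [set: T] (EFin \o X).
  apply: (@integrable_bounded_full _ _ _ P setT X 1) => //.
    exact: probability_setT.
  by move=> w _; case: (X01 w) => ->; rewrite ?normr0 ?normr1 ?ler01.
(* phi is cut off outside [0, 1] so that phi' is bounded on the whole line *)
pose phi' x := if (0 <= x) && (x <= 1) then phi x else 0.
have mphi' : measurable_fun [set: R] phi'.
  apply: measurable_fun_ifT => //.
  by apply: measurable_and; apply: measurable_fun_ler.
have phi'01 x : 0 <= phi' x <= 1.
  by rewrite /phi'; case: ifP => [/phi01//|_]; rewrite lexx ler01.
have pull (F : set (set T)) (Y : {RV P >-> R}) :
    sub_sigma_algebra_of F -> cond_expectation P X F Y ->
    \int[P]_w (phi' (Y w) * (X w - Y w)) = 0.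
  move=> [_ sF] cY; rewrite /Rintegral.
  by rewrite (@integral_pullout _ _ _ P X F Y phi' 1).
have DP w : D w -> 0 <= X1 w <= 1 /\ 0 <= X2 w <= 1 by move=> /unit_squareP.
have mphiX (Y : {RV P >-> R}) :
    measurable_fun [set: T] (fun w => phi' (Y w) * (X w - Y w)).
  by apply: measurable_funM; [exact: measurableT_comp|exact: measurable_funB].
have iphi (Y : {RV P >-> R}) : (forall w, D w -> 0 <= Y w <= 1) ->
    P.-integrable [set: T] (EFin \o (fun w => phi' (Y w) * (X w - Y w))).
  move=> Y01; apply: (@integrable_bounded_full _ _ _ P D _ 1) => //.
  move=> w /Y01 /andP[y0 y1]; rewrite normrM mulr_ile1//.
    by case/andP: (phi'01 (Y w)) => a b; rewrite ger0_norm.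
  by rewrite ler_norml; case: (X01 w) => ->; lra.
have i1 := iphi X1 (fun w Dw => proj1 (DP w Dw)).
have i2 := iphi X2 (fun w Dw => proj2 (DP w Dw)).
have i12 : P.-integrable [set: T] (EFin \o (X1 \* X2)).
  apply: (@integrable_bounded_full _ _ _ P D _ 1) => //.
  move=> w /DP[/andP[a b] /andP[a' b']].
  by rewrite /= normrM mulr_ile1// ger0_norm.
pose G w := X1 w * X2 w + phi' (X1 w) * (X w - X1 w)
  + phi' (X2 w) * (X w - X2 w).
have iG : P.-integrable [set: T] (EFin \o G).
  by apply: integrable_EFinD => //; exact: integrable_EFinD.
have IG : \int[P]_w G w = \int[P]_w (X1 w * X2 w).
  rewrite RintegralD//; last exact: integrable_EFinD.
  by rewrite RintegralD// (pull F1)// (pull F2)// !addr0.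
pose L w := c0 + (c1 - c0) * X w.
have iL1 : P.-integrable [set: T] (EFin \o cst c0).
  exact: finite_measure_integrable_cst.
have iL2 : P.-integrable [set: T] (EFin \o (fun w => (c1 - c0) * X w)).
  exact: (integrableZl measurableT (c1 - c0) iX).
have iL : P.-integrable [set: T] (EFin \o L) by exact: integrable_EFinD.
have EXR : \int[P]_w X w = p.
  by rewrite /Rintegral; move: EX; rewrite unlock => ->.
have IL : \int[P]_w L w = (1 - p) * c0 + p * c1.
  rewrite RintegralD// RintegralZl// EXR Rintegral_cst//.
  by rewrite [X in fine X](probability_setT P) mulr1; ring.
have LG w : D w -> L w <= G w.
  move=> /DP[a b]; rewrite /L /G /phi' a b.
  have := H0 _ _ a b; have := H1 _ _ a b.
  by case: (X01 w) => ->; lra.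
rewrite unlock -IL -(fineK (integrable_fin_num measurableT i12)).
rewrite -/(Rintegral P setT (X1 \* X2)) -IG.
rewrite !fineK; try exact: integrable_fin_num.
rewrite (integral_full _ _ _ mD PD iL) (integral_full _ _ _ mD PD iG).
apply: le_integral => //; try exact: (integrableS measurableT).
by move=> w /set_mem Dw; rewrite lee_fin LG.
Qed.
Lemma integrable_square {d} {T : measurableType d} {R : realType}
    (P : probability T R) (X1 X2 : {RV P >-> R}) (f : R * R -> R) :
  P (random_vector X1 X2 @^-1` unit_square) = 1%E ->
  measurable_fun [set: R * R] f ->
  (forall z, unit_square z -> `|f z| <= 1) ->
  P.-integrable [set: T] (EFin \o (f \o random_vector X1 X2)).
Proof.
move=> PD mf f1; apply: (integrable_bounded_full _ _ _ 1 _ PD).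
- exact: measurable_unit_square_preimage.
- exact: measurableT_comp.
- by move=> w; exact: f1.
Qed.

(** Coherence is a property of the joint law, and the pair in
    [coherent_covariances] need not itself consist of conditional expectations;
    this lets moments be computed on a space where it does. *)
Lemma expectation_law {d d'} {T : measurableType d} {T' : measurableType d'}
    {R : realType} (P : probability T R) (P' : probability T' R)
    (X1 X2 : {RV P >-> R}) (Y1 Y2 : {RV P' >-> R}) (f : R * R -> R) :
  (forall A, measurable A -> distribution P (random_vector X1 X2) A =
                             distribution P' (random_vector Y1 Y2) A) ->
  P (random_vector X1 X2 @^-1` unit_square) = 1%E ->
  measurable_fun [set: R * R] f ->
  (forall z, unit_square z -> `|f z| <= 1) ->
  ('E_P[f \o random_vector X1 X2] = 'E_P'[f \o random_vector Y1 Y2])%E.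
Proof.
move=> XY PD mf f1.
have P'D : P' (random_vector Y1 Y2 @^-1` unit_square) = 1%E.
  by rewrite -PD; exact: (esym (XY _ measurable_unit_square)).
have mf' : measurable_fun [set: R * R] (EFin \o f) by exact/measurable_EFinP.
rewrite unlock.
transitivity (\int[distribution P (random_vector X1 X2)]_z (EFin \o f) z)%E.
  by rewrite integral_distribution//; exact: integrable_square.
transitivity (\int[distribution P' (random_vector Y1 Y2)]_z (EFin \o f) z)%E.
  by apply: eq_measure_integral => A mA _; exact: XY.
by rewrite integral_distribution//; exact: integrable_square.
Qed.

Lemma covariance_coherent {d} {T : measurableType d} {R : realType}
    (P : probability T R) (p : R) (X1 X2 : {RV P >-> R}) :
  coherent p (distribution P (random_vector X1 X2)) ->
  exists (d' : measure_display) (T' : measurableType d') (Q : probability T' R)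
      (Y Y1 Y2 : {RV Q >-> R}),
    coherent_model Q p Y Y1 Y2 /\
    covariance P X1 X2 = ('E_Q[(Y1 \* Y2)%R] - (p ^+ 2)%:E)%E.
Proof.
case=> PD [d' [T' [Q [Y [F1 [F2 [Y1 [Y2 []]]]]]]]].
move=> Y01 EY [sF1 sF2] [cY1 cY2] XY.
exists d', T', Q, Y, Y1, Y2; split.
  exists F1, F2; split => //.
  by rewrite -PD; exact: (esym (XY _ measurable_unit_square)).
have bsq z : @unit_square R z ->
    [/\ `|z.1| <= 1, `|z.2| <= 1 & `|z.1 * z.2| <= 1].
  move=> /unit_squareP[/andP[a b] /andP[c e]].
  by rewrite normrM mulr_ile1// !ger0_norm.
have m1 : measurable_fun [set: R * R] (@fst R R) by exact: measurable_fst.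
have m2 : measurable_fun [set: R * R] (@snd R R) by exact: measurable_snd.
have m12 : measurable_fun [set: R * R] (fun z => z.1 * z.2).
  exact: measurable_funM.
have E1 : ('E_P[X1] = p%:E)%E.
  rewrite -EY -(expectation_cond _ _ _ _ sF1 cY1).
  by apply: (expectation_law _ _ X1 X2 Y1 Y2 fst) => // z /bsq[].
have E2 : ('E_P[X2] = p%:E)%E.
  rewrite -EY -(expectation_cond _ _ _ _ sF2 cY2).
  by apply: (expectation_law _ _ X1 X2 Y1 Y2 snd) => // z /bsq[].
rewrite covarianceE; first last.
- apply/Lfun1_integrable.
  by apply: (integrable_square _ X1 X2 (fun z => z.1 * z.2)) => // z /bsq[].
- apply/Lfun1_integrable.
  by apply: (integrable_square _ X1 X2 snd) => // z /bsq[].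
- apply/Lfun1_integrable.
  by apply: (integrable_square _ X1 X2 fst) => // z /bsq[].
rewrite E1 E2 -EFinM -expr2; congr (_ - _)%E.
by apply: (expectation_law _ _ X1 X2 Y1 Y2 (fun z => z.1 * z.2)) => // z /bsq[].
Qed.


Lemma covariance_ge_dual {d} {T : measurableType d} {R : realType}
    (P : probability T R) (p : R) (X1 X2 : {RV P >-> R})
    (phi : R -> R) (c0 c1 : R) :
  coherent p (distribution P (random_vector X1 X2)) ->
  measurable_fun [set: R] phi ->
  (forall x, 0 <= x <= 1 -> 0 <= phi x <= 1) ->
  (forall x y, 0 <= x <= 1 -> 0 <= y <= 1 ->
     c0 <= x * y - x * phi x - y * phi y) ->
  (forall x y, 0 <= x <= 1 -> 0 <= y <= 1 ->
     c1 <= x * y + (1 - x) * phi x + (1 - y) * phi y) ->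
  (((1 - p) * c0 + p * c1 - p ^+ 2)%:E <= covariance P X1 X2)%E.
Proof.
move=> /covariance_coherent[d' [T' [Q [Y [Y1 [Y2 [model ->]]]]]]].
move=> mphi phi01 H0 H1; rewrite EFinB leeB//.
exact: expectation_ge_dual model mphi phi01 H0 H1.
Qed.

(** * Four-point coherent laws *)

(** The natural numbers serve as sample space because every subset and every
    function on them is measurable. *)
Lemma finite_probability {R : realType} (n : nat) (w : nat -> R) :
  (forall i, 0 <= w i) -> \sum_(i < n) w i = 1 ->
  exists P : probability nat R, forall (A : set nat) (f : nat -> R),
    (forall i, 0 <= f i) ->
    (\int[P]_(k in A) (f k)%:E
     = (\sum_(i < n) w i * (((i : nat) \in A)%:R * f i))%:E)%E.
Proof.
move=> w0 w1.
pose mu : {measure set nat -> \bar R} :=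
  msum (fun i : nat => mscale (NngNum (w0 i)) \d_i) n.
have muE (A : set nat) (f : nat -> R) : (forall i, 0 <= f i) ->
    (\int[mu]_(k in A) (f k)%:E
     = (\sum_(i < n) w i * (((i : nat) \in A)%:R * f i))%:E)%E.
  move=> f0.
  have f0' k : A k -> (0 <= (f k)%:E)%E by rewrite lee_fin.
  rewrite ge0_integral_measure_sum// -sumEFin; apply: eq_bigr => i _.
  by rewrite ge0_integral_mscale//= integral_dirac// diracE.
have mu1 : mu setT = 1%E.
  have := integral_cst mu measurableT 1%E; rewrite mul1e => <-.
  apply: (etrans (muE setT (cst 1) (fun=> ler01))); congr EFin.
  by rewrite -[RHS]w1; apply: eq_bigr => i _; rewrite in_setT /= !mulr1.
pose P : probability nat R := mnormalize mu \d_0%N.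
have Pmu A : P A = mu A.
  by rewrite /P /= /mnormalize mu1 onee_eq0/= invr1 mule1.
exists P => A f f0; rewrite -muE//.
by apply: eq_measure_integral => B _ _; exact: Pmu.
Qed.

(** The outcomes 0, 1, 2, 3 are the edges of the path 0 - y1 - x - y2 - 1, with
    masses [a], [b], [c], [e] and X = 0, 1, 0, 1.  The two edges at an inner
    vertex form an atom of the sigma-algebra of the corresponding coordinate,
    and the three mass equations say that each inner vertex is the conditional
    probability of X = 1 there; the end vertices 0 and 1 satisfy this
    automatically. *)
Lemma chain_covariance {R : realType} (a b c e x y1 y2 : R) :
  0 <= a -> 0 <= b -> 0 <= c -> 0 <= e -> a + b + c + e = 1 ->
  0 <= x <= 1 -> 0 <= y1 <= 1 -> 0 <= y2 <= 1 ->
  b = x * (b + c) -> b = y1 * (a + b) -> e = y2 * (c + e) ->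
  coherent_covariances (b + e)
    (b * (x * y1) + c * (x * y2) + e * y2 - (b + e) ^+ 2)%:E.
Proof.
move=> a0 b0 c0 e0 abce1 /andP[x0 x1] /andP[y10 y11] /andP[y20 y21] bx by1 ey2.
pose w := nth 0 [:: a; b; c; e].
have w0 i : 0 <= w i by case: i => [|[|[|[|i]]]]//=; rewrite /w/= nth_nil.
have sum4 (F : nat -> R) : \sum_(i < 4) F i = F 0%N + F 1%N + F 2%N + F 3%N.
  by rewrite !big_ord_recr big_ord0 /= add0r.
have w1 : \sum_(i < 4) w i = 1 by rewrite sum4.
have [P PE] := finite_probability 4 w w0 w1.
have IE (A : set nat) (s : seq R) : all (fun r => 0 <= r) s ->
  (\int[P]_(k in A) (nth 0 s k)%:E =
   (a * ((0%N \in A)%:R * s`_0) + b * ((1%N \in A)%:R * s`_1)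
    + c * ((2%N \in A)%:R * s`_2) + e * ((3%N \in A)%:R * s`_3))%:E)%E.
  move=> s0; rewrite PE; last first.
    move=> i; have [si|si] := ltnP i (size s); last by rewrite nth_default.
    exact: (all_nthP 0 s0).
  by rewrite (sum4 (fun i => w i * ((i \in A)%:R * s`_i))).
have mnat (f : nat -> R) : measurable_fun [set: nat] f by [].
pose X : {RV P >-> R} := HB.pack (nth 0 [:: 0; 1; 0; 1] : nat -> R)
  (isMeasurableFun.Build _ _ _ _ _ (mnat (nth 0 [:: 0; 1; 0; 1]))).
pose X1 : {RV P >-> R} := HB.pack (nth 0 [:: 0; x; x; 1] : nat -> R)
  (isMeasurableFun.Build _ _ _ _ _ (mnat (nth 0 [:: 0; x; x; 1]))).
pose X2 : {RV P >-> R} := HB.pack (nth 0 [:: y1; y1; y2; y2] : nat -> R)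
  (isMeasurableFun.Build _ _ _ _ _ (mnat (nth 0 [:: y1; y1; y2; y2]))).
pose F1 : set (set nat) := [set A | A 1%N <-> A 2%N].
pose F2 : set (set nat) := [set A | (A 0%N <-> A 1%N) /\ (A 2%N <-> A 3%N)].
have sF1 : sub_sigma_algebra_of F1.
  split; last by [].
  split => //.
  - by move=> A /= [h1 h2]; split => -[_ nA]; split => // h; apply: nA; tauto.
  - move=> A FA; split => -[i _ h]; exists i => //; exact/(FA i).
have sF2 : sub_sigma_algebra_of F2.
  split; last by [].
  split => //.
  - move=> A /= [h1 h2].
    by split; split => -[_ nA]; split => // h; apply: nA; tauto.
  - move=> A FA; split; split => -[i _ h]; exists i => //;
      have [g1 g2] := FA i; tauto.
have i01 (s : seq R) k : all (fun r => 0 <= r <= 1) s -> 0 <= nth 0 s k <= 1.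
  move=> s01; have [ks|ks] := ltnP k (size s); first exact: (all_nthP 0 s01).
  by rewrite nth_default// lexx ler01.
have X1_01 k : 0 <= X1 k <= 1 by apply: i01; rewrite /= x0 x1 !lexx !ler01.
have X2_01 k : 0 <= X2 k <= 1 by apply: i01; rewrite /= y10 y11 y20 y21.
have int01 (Y : {RV P >-> R}) : (forall k, 0 <= Y k <= 1) ->
    P.-integrable [set: nat] (EFin \o Y).
  move=> Y01; apply: (integrable_bounded_full _ setT _ 1) => //.
    exact: probability_setT.
  by move=> k _; case/andP: (Y01 k) => ? ?; rewrite ger0_norm.
have pos : all (fun r : R => 0 <= r) [:: 0; 1; 0; 1] by rewrite /= !lexx !ler01.
have pos1 : all (fun r => 0 <= r) [:: 0; x; x; 1] by rewrite /= x0 !lexx !ler01.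
have pos2 : all (fun r => 0 <= r) [:: y1; y1; y2; y2] by rewrite /= y10 y20.
have c1 : cond_expectation P X F1 X1.
  split; [by []|exact: int01|].
  move=> A [A12 A21].
  rewrite (IE A [:: 0; x; x; 1] pos1) (IE A [:: 0; 1; 0; 1] pos) /=.
  have -> : (2%N \in A) = (1%N \in A).
    by apply/idP/idP => /set_mem h; apply/mem_set; tauto.
  by congr EFin; case: (1%N \in A); rewrite ?mulr1n ?mulr0n; [lra|ring].
have c2 : cond_expectation P X F2 X2.
  split; [by []|exact: int01|].
  move=> A [[A01 A10] [A23 A32]].
  rewrite (IE A [:: y1; y1; y2; y2] pos2) (IE A [:: 0; 1; 0; 1] pos) /=.
  have -> : (1%N \in A) = (0%N \in A).
    by apply/idP/idP => /set_mem h; apply/mem_set; tauto.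
  have -> : (3%N \in A) = (2%N \in A).
    by apply/idP/idP => /set_mem h; apply/mem_set; tauto.
  congr EFin; case: (0%N \in A); case: (2%N \in A);
    by rewrite ?mulr1n ?mulr0n; lra.
have EX : ('E_P[X] = (b + e)%:E)%E.
  rewrite unlock (IE setT [:: 0; 1; 0; 1] pos) /=.
  by rewrite !in_setT !mul1r; congr EFin; ring.
have cpl : coherent (b + e) (distribution P (random_vector X1 X2)).
  split.
    rewrite -(probability_setT P); congr (P _).
    apply/seteqP; split => // k _; apply/(unit_squareP (X1 k, X2 k)).
    exact: (conj (X1_01 k) (X2_01 k)).
  exists _, nat, P, X, F1, F2, X1, X2; split => //.
  case=> [|[|[|[|k]]]] /=; rewrite /X/= ?nth_nil;
    by [left|right|left|right|left].
exists _, nat, P, X1, X2; split => //.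
rewrite covarianceE; first last.
- apply/Lfun1_integrable; apply: (integrable_bounded_full _ setT _ 1) => //.
    exact: probability_setT.
  move=> k _; have /andP[? ?] := X1_01 k; have /andP[? ?] := X2_01 k.
  by rewrite fctE normrM mulr_ile1// ger0_norm.
- by apply/Lfun1_integrable; exact: int01.
- by apply/Lfun1_integrable; exact: int01.
rewrite (expectation_cond _ _ _ _ sF1 c1) (expectation_cond _ _ _ _ sF2 c2) EX.
rewrite -EFinM -expr2 EFinB; congr (_ - _)%E.
rewrite unlock; have := IE setT [:: 0 * y1; x * y1; x * y2; 1 * y2].
rewrite /= !mulr_ge0// => /(_ isT) E12.
rewrite (eq_integral
  (fun k => (nth 0 [:: 0 * y1; x * y1; x * y2; 1 * y2] k)%:E)).
  by rewrite E12 !in_setT !mul1r; congr EFin; ring.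
move=> k _; congr EFin; rewrite fctE /X1 /X2 /=.
by case: k => [|[|[|[|k]]]] //=; rewrite !nth_nil mulr0.
Qed.

(** * The minimal covariance *)

(** The masses are the solution of the mass equations of [chain_covariance]
    along the path 0 - 3p/2 - 1/2 - (3p-1)/2 - 1, on which
    [X1 + X2 = 3p/2 + X/2]. *)
Lemma min_middle {R : realType} (p : R) : 0 < p < 1 -> 1 / 3 <= p <= 2 / 3 ->
  is_minimum (coherent_covariances p) (- (1 / 8) * (p * (1 - p)))%:E.
Proof.
move=> /andP[p0 p1] /andP[pl pu]; split.
  have := @chain_covariance R ((1 - p) * (2 - 3 * p) / 2) (3 * p * (1 - p) / 2)
    (3 * p * (1 - p) / 2) (p * (3 * p - 1) / 2)
    (1 / 2) (3 * p / 2) ((3 * p - 1) / 2).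
  have -> : 3 * p * (1 - p) / 2 + p * (3 * p - 1) / 2 = p by field.
  rewrite [X in X%:E](_ : _ = - (1 / 8) * (p * (1 - p))); last by field.
  apply; try by apply/andP; split; lra.
  - by rewrite divr_ge0// mulr_ge0//; lra.
  - by rewrite divr_ge0// !mulr_ge0//; lra.
  - by rewrite divr_ge0// !mulr_ge0//; lra.
  - by rewrite divr_ge0// mulr_ge0//; lra.
  - by field.
  - by field.
  - by field.
  - by field.
move=> _ [d [T [P [X1 [X2 [coh ->]]]]]].
pose b := 3 * p / 2.
have := covariance_ge_dual P p X1 X2 (fun x => b - x / 2) (- (b ^+ 2 / 2))
  (2 * b - (b + 1 / 2) ^+ 2 / 2) coh.
rewrite [X in (X%:E <= _)%E](_ : _ = - (1 / 8) * (p * (1 - p))); last first.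
  by rewrite /b; field.
apply.
- apply: nonincreasing_measurable => // x y xy; lra.
- by move=> x /andP[x0 x1]; rewrite /b; apply/andP; split; lra.
- move=> x y _ _; have := sqr_ge0 (x + y - b); rewrite !expr2; lra.
- move=> x y _ _; have := sqr_ge0 (x + y - b - 1 / 2); rewrite !expr2; lra.
Qed.

(** The path 0 - t - t - 0: the last edge of the four-edge path has mass 0,
    and all of X = 1 sits at the point [(t, t)]. *)
Lemma min_low {R : realType} (p : R) : 0 < p <= 1 / 3 ->
  is_minimum (coherent_covariances p) (- (p * (1 - p) / (1 + p)) ^+ 2)%:E.
Proof.
move=> /andP[p0 p3].
pose t := 2 * p / (1 + p).
have pne : 1 + p != 0 by rewrite gt_eqF//; lra.
have t0 : 0 < t by rewrite divr_gt0//; lra.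
have th : t <= 1 / 2 by rewrite ler_pdivrMr; lra.
split.
  have := @chain_covariance R ((1 - p) / 2) p ((1 - p) / 2) 0 t t 0.
  rewrite !addr0.
  rewrite [X in X%:E](_ : _ = - (p * (1 - p) / (1 + p)) ^+ 2); last first.
    by rewrite /t; field.
  apply => //; try lra.
  - by rewrite /t; field.
  - by rewrite /t; field.
move=> _ [d [T [P [X1 [X2 [coh ->]]]]]].
have tP : 0 < t <= 1 / 2 by apply/andP.
have := covariance_ge_dual P p X1 X2 (dual_potential t) (- t ^+ 3)
  (3 * t ^+ 2 - 2 * t ^+ 3) coh.
rewrite [X in (X%:E <= _)%E](_ : _ =
  - (p * (1 - p) / (1 + p)) ^+ 2); last first.
  by rewrite /t; field.
apply.
- exact: measurable_dual_potential.
- by move=> x; exact: dual_potential01.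
- move=> x y /andP[x0 _] /andP[y0 _].
  by have := dual_potential_feasible0 t x y tP x0 y0; lra.
- by move=> x y; exact: dual_potential_feasible1.
Qed.

(** The reflection [x |-> 1 - x] of [min_low] with [1 - p] for [p]: here it is
    the first edge that has mass 0, and the roles of the two feasibility
    inequalities are exchanged. *)
Lemma min_high {R : realType} (p : R) : 2 / 3 <= p < 1 ->
  is_minimum (coherent_covariances p) (- (p * (1 - p) / (2 - p)) ^+ 2)%:E.
Proof.
move=> /andP[p3 p1].
pose t := 2 * (1 - p) / (2 - p).
have pne : 2 - p != 0 by rewrite gt_eqF//; lra.
have t0 : 0 < t by rewrite divr_gt0//; lra.
have th : t <= 1 / 2 by rewrite ler_pdivrMr; lra.
split.
  have := @chain_covariance R 0 (p / 2) (1 - p) (p / 2) (1 - t) 1 (1 - t).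
  have -> : p / 2 + p / 2 = p by field.
  rewrite [X in X%:E](_ : _ = - (p * (1 - p) / (2 - p)) ^+ 2); last first.
    by rewrite /t; field.
  apply => //; try lra; try by apply/andP; split; lra.
  - by rewrite /t; field.
  - by rewrite /t; field.
move=> _ [d [T [P [X1 [X2 [coh ->]]]]]].
have tP : 0 < t <= 1 / 2 by apply/andP.
have := covariance_ge_dual P p X1 X2 (fun x => 1 - dual_potential t (1 - x))
  (3 * t ^+ 2 - 2 * t ^+ 3 - 1) (1 - t ^+ 3) coh.
rewrite [X in (X%:E <= _)%E](_ : _ =
  - (p * (1 - p) / (2 - p)) ^+ 2); last first.
  by rewrite /t; field.
have flip (x : R) : 0 <= x <= 1 -> 0 <= 1 - x <= 1 by lra.
apply.
- apply: nonincreasing_measurable => // x y xy.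
  by rewrite lerD2l lerN2; apply: dual_potential_nonincreasing => //; lra.
- by move=> x /flip /(dual_potential01 _ _ tP); lra.
- move=> x y /flip x01 /flip y01.
  by have := dual_potential_feasible1 t _ _ tP x01 y01; lra.
- move=> x y /flip/andP[x0 _] /flip/andP[y0 _].
  by have := dual_potential_feasible0 t _ _ tP x0 y0; lra.
Qed.

Theorem corollary2p7 (R : realType) (p : R) (hp : 0 < p < 1) :
  exists m : \bar R,
    [/\ is_minimum (coherent_covariances p) m,
        p \in `[1 / 3, 2 / 3] -> m = (- (1 / 8) * (p * (1 - p)))%:E &
        p \notin `[1 / 3, 2 / 3] -> ((- (1 / 8) * (p * (1 - p)))%:E < m)%E].
Proof.
have [p0 p1] := andP hp.
have gap (q a s : R) : 0 < q -> a != 0 -> s != 0 ->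
  0 < q * a ^+ 2 / (8 * s ^+ 2).
  have sq (z : R) : z != 0 -> 0 < z ^+ 2 by move=> z0; rewrite exprn_even_gt0.
  by move=> q0 /sq a2 /sq s2; rewrite divr_gt0// mulr_gt0.
have pp0 : 0 < p * (1 - p) by rewrite mulr_gt0 ?subr_gt0.
rewrite in_itv/=.
have [p3|p3] := ltP p (1 / 3).
  exists (- (p * (1 - p) / (1 + p)) ^+ 2)%:E; split => //.
    by apply: min_low; rewrite p0 ltW.
  move=> _; rewrite lte_fin -subr_gt0.
  have -> : - (p * (1 - p) / (1 + p)) ^+ 2 - - (1 / 8) * (p * (1 - p))
    = p * (1 - p) * (3 * p - 1) ^+ 2 / (8 * (1 + p) ^+ 2) by field; lra.
  by apply: gap => //; lra.
have [p23|p23] := leP p (2 / 3); last first.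
  exists (- (p * (1 - p) / (2 - p)) ^+ 2)%:E; split => //.
    by apply: min_high; rewrite p1 ltW.
  move=> _; rewrite lte_fin -subr_gt0.
  have -> : - (p * (1 - p) / (2 - p)) ^+ 2 - - (1 / 8) * (p * (1 - p))
    = p * (1 - p) * (3 * p - 2) ^+ 2 / (8 * (2 - p) ^+ 2) by field; lra.
  by apply: gap => //; lra.
exists (- (1 / 8) * (p * (1 - p)))%:E; split => //.
by apply: min_middle => //; rewrite p3 p23.
Qed.
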